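(* Let $X,Y$ be real normed spaces with $\dim X\ge 2$ and let $T:X\to Y$ be a nonzero linear mapping such that $$x\perp_I y\ \Longrightarrow\ Tx\perp_{\rho_*}Ty\qquad (x,y\in X).$$ Then $$\frac{1}{3}\|T\|\,\|x\|\le \|Tx\|\le 3[T]\,\|x\|\qquad (x\in X),$$ where $[T]:=\inf\{\|Tx\|:\ x\in X,\ \|x\|=1\}$.
   Context: $\|T\|=\sup\{\|Tx\|:\|x\|=1\}$ is the operator norm. For $x,y$ in a real normed space, isosceles orthogonality is: $x\perp_I y$ iff $\|x+y\|=\|x-y\|$. The norm derivatives on a real normed space are $\rho_{\pm}(x,y):=\lim_{t\to 0^{\pm}}\frac{\|x+ty\|^2-\|x\|^2}{2t}$. Put $\rho_*(x,y):=\rho_-(x,y)\rho_+(x,y)$, and $x\perp_{\rho_*}y$ iff $\rho_*(x,y)=0$. *)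

(* Defs.v *)
From HB Require Import structures.
From mathcomp Require Import all_boot all_order all_algebra.
From mathcomp Require Import all_classical all_reals all_analysis.
Set Implicit Arguments.
Unset Strict Implicit.
Unset Printing Implicit Defensive.
Import Order.TTheory GRing.Theory Num.Theory.
Import numFieldNormedType.Exports.
Local Open Scope classical_set_scope.
Local Open Scope ring_scope.

(* The space V need not be finite-dimensional, so "dim V >= n" is stated as
   the existence of n linearly independent vectors. *)
Definition dim_ge (R : realType) (V : normedModType R) (n : nat) : Prop :=
  exists v : 'I_n -> V,
    forall c : 'I_n -> R, \sum_(i < n) c i *: v i = 0 -> forall i, c i = 0.

(* Both extrema are taken in \bar R: no boundedness of the map is assumed, and
   the real-valued [sup] would return 0 on an unbounded set. *)
Definition opnorm (R : realType) (V W : normedModType R) (f : V -> W) : \bar R :=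
  ereal_sup [set `|f x|%:E | x in [set x : V | `|x| = 1]].

Definition minnorm (R : realType) (V W : normedModType R) (f : V -> W) : \bar R :=
  ereal_inf [set `|f x|%:E | x in [set x : V | `|x| = 1]].

Definition iso_orth (R : realType) (V : normedModType R) (x y : V) : Prop :=
  `|x + y| = `|x - y|.

(* By convexity of the norm the two one-sided limits below always exist, so
   the totality of [lim] plays no role. *)
Definition rho_plus (R : realType) (V : normedModType R) (x y : V) : R :=
  lim ((`|x + t *: y| ^+ 2 - `|x| ^+ 2) / (2 * t) @[t --> (0 : R)^'+]).

Definition rho_minus (R : realType) (V : normedModType R) (x y : V) : R :=
  lim ((`|x + t *: y| ^+ 2 - `|x| ^+ 2) / (2 * t) @[t --> (0 : R)^'-]).

Definition rho_star (R : realType) (V : normedModType R) (x y : V) : R :=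
  rho_minus x y * rho_plus x y.

Definition rho_star_orth (R : realType) (V : normedModType R) (x y : V) : Prop :=
  rho_star x y = 0.

(* Main.v *)
Require Import Defs.
From HB Require Import structures.
From mathcomp Require Import all_boot all_order all_algebra.
From mathcomp Require Import all_classical all_reals all_analysis.
From mathcomp Require Import ring lra.
Import Order.TTheory GRing.Theory Num.Theory.
Import numFieldNormedType.Exports.
Local Open Scope classical_set_scope.
Local Open Scope ring_scope.

(** Along every line the squared norm is a convex function of the parameter, so
    its difference quotient at a point is nondecreasing, and the two norm
    derivatives are its one-sided limits at that point.  If one of them is zero
    then the quotient is nonnegative to the right and nonpositive to the left:
    the norm is minimal there.  Hence rho_*-orthogonality implies Birkhoff
    orthogonality: |x| <= |x + t y| for all t ([rho_star_orth_birkhoff]).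

    If |x| = |y|, then x + y and x - y are isosceles orthogonal, as their sum
    and difference are 2x and 2y.  By hypothesis T(x + y) is then rho_*-, hence
    Birkhoff-orthogonal to T(x - y), and t = -1 gives |T(x + y)| <= 2|Ty|.
    Since Tx = T(x + y) - Ty, it follows that |Tx| <= 3|Ty|
    ([norm_image_le3]).  Taking the supremum over x, or the infimum over y, in
    the unit sphere gives the two estimates by homogeneity; the first one
    contains the boundedness of T. *)

(** This is convexity of the squared norm on the line, with the denominators
    cleared so that the position of 0 among the points does not matter. *)
Lemma sqr_norm_line_convex (R : realType) (V : normedModType R) (x y : V)
    (a b c : R) : a < b -> b < c ->
  (c - a) * `|x + b *: y| ^+ 2 <=
  (c - b) * `|x + a *: y| ^+ 2 + (b - a) * `|x + c *: y| ^+ 2.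
Proof.
move=> ab bc.
have E : (c - a) *: (x + b *: y) =
    (c - b) *: (x + a *: y) + (b - a) *: (x + c *: y).
  rewrite !scalerDr !scalerA addrACA -!scalerDl.
  by congr (_ *: _ + _ *: _); ring.
have : `|(c - a) *: (x + b *: y)| <=
    `|(c - b) *: (x + a *: y)| + `|(b - a) *: (x + c *: y)|.
  by rewrite E ler_normD.
rewrite !normrZ !gtr0_norm ?subr_gt0 //; last exact: lt_trans bc.
move: (normr_ge0 (x + a *: y)) (normr_ge0 (x + b *: y)).
move: (normr_ge0 (x + c *: y)).
move: `|x + a *: y| `|x + b *: y| `|x + c *: y| => A B C C0 A0 B0.
have -> : c - a = (c - b) + (b - a) by ring.
have : 0 < c - b by rewrite subr_gt0.
have : 0 < b - a by rewrite subr_gt0.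
move: (c - b) (b - a) => p q q0 p0 le1.
(* (p A + q C)^2 + p q (A - C)^2 = (p + q) (p A^2 + q C^2) *)
have pq0 : 0 < p + q by rewrite addr_gt0.
rewrite -(ler_pM2l pq0).
apply: (@le_trans _ _ ((p * A + q * C) ^+ 2)).
  have -> : (p + q) * ((p + q) * B ^+ 2) = ((p + q) * B) ^+ 2 by ring.
  by rewrite ler_sqr ?nnegrE ?addr_ge0 ?mulr_ge0 // ltW.
rewrite -subr_ge0.
have -> : (p + q) * (p * A ^+ 2 + q * C ^+ 2) - (p * A + q * C) ^+ 2 =
  p * q * (A - C) ^+ 2 by ring.
by apply: mulr_ge0; [apply: mulr_ge0; exact: ltW|exact: sqr_ge0].
Qed.

Definition sqr_norm_slope (R : realType) (V : normedModType R) (x y : V)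
  (t : R) : R := (`|x + t *: y| ^+ 2 - `|x| ^+ 2) / (2 * t).

Lemma sqr_norm_slope_nondecreasing (R : realType) (V : normedModType R)
    (x y : V) (s t : R) : s != 0 -> t != 0 -> s <= t ->
  sqr_norm_slope R V x y s <= sqr_norm_slope R V x y t.
Proof.
move=> s0 t0; rewrite le_eqVlt => /predU1P[->//|st].
have conv a b c := @sqr_norm_line_convex R V x y a b c.
have norm0 : `|x + 0 *: y| = `|x| by rewrite scale0r addr0.
have halve u : u != 0 -> sqr_norm_slope R V x y u =
    2^-1 * ((`|x + u *: y| ^+ 2 - `|x| ^+ 2) / u).
  by move=> u0; rewrite /sqr_norm_slope; field.
rewrite !halve // ler_pM2l ?invr_gt0 //.
case: (ltgtP s 0) (s0) => // [s_neg|s_pos] _; last first.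
- have t_pos : 0 < t by exact: lt_trans st.
  rewrite ler_pdivrMr // mulrAC ler_pdivlMr //.
  by have := conv _ _ _ s_pos st; rewrite norm0; lra.
- rewrite [leLHS](_ : _ = (`|x| ^+ 2 - `|x + s *: y| ^+ 2) / - s); last by field.
  have s'_pos : 0 < - s by rewrite oppr_gt0.
  rewrite ler_pdivrMr // mulrAC.
  case: (ltgtP t 0) (t0) => // [t_neg|t_pos] _.
  + rewrite [leRHS](_ : _ =
      (`|x| ^+ 2 - `|x + t *: y| ^+ 2) * - s / - t); last by field.
    rewrite ler_pdivlMr ?oppr_gt0 //.
    by have := conv _ _ _ st t_neg; rewrite norm0; lra.
  + rewrite ler_pdivlMr //.
    by have := conv _ _ _ s_neg t_pos; rewrite norm0; lra.
Qed.

(** The quotient at any negative parameter bounds from below the quotients at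
    positive ones, so the limit exists; monotonicity then compares. *)
Lemma rho_plus_bounds (R : realType) (V : normedModType R) (x y : V) :
  (forall t, 0 < t -> rho_plus x y <= sqr_norm_slope R V x y t) /\
  (forall t, t < 0 -> sqr_norm_slope R V x y t <= rho_plus x y).
Proof.
rewrite /rho_plus -/(sqr_norm_slope R V x y).
have mono := @sqr_norm_slope_nondecreasing R V x y.
have cvg_slope : cvg (sqr_norm_slope R V x y t @[t --> (0 : R)^'+]).
  apply: nondecreasing_at_right_is_cvgr; apply: nearW => e.
    move=> s t; rewrite !in_itv /= => /andP[s0 _] /andP[t0 _].
    by apply: mono; rewrite gt_eqF.
  exists (sqr_norm_slope R V x y (- 1)) => _ [t + <-].
  rewrite /= in_itv /= => /andP[t0 _].
  by apply: mono; [rewrite oppr_eq0 oner_eq0|rewrite gt_eqF|lra].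
split=> t t0.
  apply: limr_le => //; near=> s.
  have s0 : 0 < s by near: s; exact: nbhs_right_gt.
  apply: mono; rewrite ?gt_eqF //.
  by near: s; exact: nbhs_right_ltW.
apply: limr_ge => //; near=> s.
have s0 : 0 < s by near: s; exact: nbhs_right_gt.
by apply: mono; rewrite ?(lt_eqF t0) ?(gt_eqF s0) //; lra.
Unshelve. all: by end_near. Qed.

Lemma rho_minus_bounds (R : realType) (V : normedModType R) (x y : V) :
  (forall t, 0 < t -> rho_minus x y <= sqr_norm_slope R V x y t) /\
  (forall t, t < 0 -> sqr_norm_slope R V x y t <= rho_minus x y).
Proof.
rewrite /rho_minus -/(sqr_norm_slope R V x y).
have mono := @sqr_norm_slope_nondecreasing R V x y.
have cvg_slope : cvg (sqr_norm_slope R V x y t @[t --> (0 : R)^'-]).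
  apply: nondecreasing_at_left_is_cvgr; apply: nearW => e.
    move=> s t; rewrite !in_itv /= => /andP[_ s0] /andP[_ t0].
    by apply: mono; rewrite lt_eqF.
  exists (sqr_norm_slope R V x y 1) => _ [t + <-].
  rewrite /= in_itv /= => /andP[_ t0].
  by apply: mono; [rewrite lt_eqF|rewrite oner_eq0|lra].
split=> t t0.
  apply: limr_le => //; near=> s.
  have s0 : s < 0 by near: s; exact: nbhs_left_lt.
  by apply: mono; rewrite ?(lt_eqF s0) ?(gt_eqF t0) //; lra.
apply: limr_ge => //; near=> s.
have s0 : s < 0 by near: s; exact: nbhs_left_lt.
apply: mono; rewrite ?lt_eqF //.
by apply/ltW; near: s; exact: nbhs_left_gt.
Unshelve. all: by end_near. Qed.

(** Each one-sided derivative alone separates the quotients at negative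
    parameters from those at positive ones, so it does not matter which of the
    two factors of rho_* vanishes. *)
Lemma rho_star_orth_birkhoff (R : realType) (V : normedModType R) (x y : V) :
  rho_star_orth x y -> forall t : R, `|x| <= `|x + t *: y|.
Proof.
move=> /eqP; rewrite /rho_star mulf_eq0 => rho0.
have [slope_ge0 slope_le0] :
    (forall t, 0 < t -> 0 <= sqr_norm_slope R V x y t) /\
    (forall t, t < 0 -> sqr_norm_slope R V x y t <= 0).
  case/orP: rho0 => /eqP rho0.
    by have := rho_minus_bounds R V x y; rewrite rho0.
  by have := rho_plus_bounds R V x y; rewrite rho0.
move=> t; rewrite -ler_sqr ?nnegrE // -subr_ge0.
have [t_neg|t_pos|->] := ltgtP t 0; last by rewrite scale0r addr0 subrr.
- have := slope_le0 t t_neg; rewrite /sqr_norm_slope.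
  by rewrite ler_ndivrMr ?mul0r // pmulr_rlt0.
- have := slope_ge0 t t_pos; rewrite /sqr_norm_slope.
  by rewrite ler_pdivlMr ?mul0r // mulr_gt0.
Qed.

Lemma norm_image_le3 (R : realType) (X Y : normedModType R)
    (T : {linear X -> Y})
    (T_orth : forall x y : X, iso_orth x y -> rho_star_orth (T x) (T y))
    (x y : X) : `|x| = `|y| -> `|T x| <= 3 * `|T y|.
Proof.
move=> xy.
have iso : iso_orth (x + y) (x - y).
  rewrite /iso_orth opprB addrACA subrr addr0 [x + y]addrC addrACA subrr addr0.
  by rewrite -!mulr2n !normrMn xy.
have := rho_star_orth_birkhoff R Y _ _ (T_orth _ _ iso) (- 1).
rewrite scaleN1r -linearB opprB [x + y]addrC addrACA subrr addr0 -mulr2n.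
rewrite linearMn normrMn linearD -mulr_natl => le2.
have := ler_normB (T y + T x) (T y).
by rewrite [T y + T x]addrC addrK [T x + T y]addrC; lra.
Qed.

Theorem theorem2p9 (R : realType) (X Y : normedModType R)
    (dimX : dim_ge X 2)
    (T : {linear X -> Y})
    (T_neq0 : exists x : X, T x <> 0)
    (T_orth : forall x y : X, iso_orth x y -> rho_star_orth (T x) (T y)) :
  forall x : X,
    ((1 / 3 : R)%:E * opnorm T * `|x|%:E <= `|T x|%:E)%E /\
    (`|T x|%:E <= (3 : R)%:E * minnorm T * `|x|%:E)%E.
Proof.
move=> x; have [->|x0] := eqVneq x 0.
  by rewrite linear0 !normr0 !mule0.
have nx0 : 0 < `|x| by rewrite normr_gt0.
pose u := `|x|^-1 *: x.
have nu : `|u| = 1 by rewrite normrZ normfV normr_id mulVf // gt_eqF.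
have -> : `|T x|%:E = (`|T u|%:E * `|x|%:E)%E.
  by rewrite -EFinM linearZ normrZ normfV normr_id mulrAC mulVf ?mul1r ?gt_eqF.
have third : 1 / 3 = 3^-1 :> R by rewrite div1r.
split; rewrite lee_pmul2r ?lte_fin //.
  rewrite third lee_pdivrMl //; apply: ge_ereal_sup => _ [v /= nv <-].
  by rewrite -EFinM lee_fin; apply: norm_image_le3 => //; rewrite nv nu.
rewrite -[3 in leRHS]invrK lee_pdivlMl ?invr_gt0 //.
apply: le_ereal_inf_tmp => _ [v /= nv <-].
rewrite -EFinM lee_fin mulrC ler_pdivrMr // mulrC.
by apply: norm_image_le3 => //; rewrite nv nu.
Qed.
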